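(* Let $G$ be a virtually (non-abelian) free group and let $H$ be a subgroup of $G$ of finite index $[G:H] \ge 3$. Then the double $G *_{H} G$ is virtually the direct product $F_{r_1} \times F_{r_2}$ of two non-abelian free groups of finite rank. In particular, if $G$ is a non-abelian free group, then $F_2 \times F_2$ and $G *_{H} G$ have a common subgroup of finite index, i.e. there is a group isomorphic both to a finite index subgroup of $F_2 \times F_2$ and to a finite index subgroup of $G *_{H} G$.
   Context: $F_r$ denotes the free group of rank $r$. For a group $G$ and a subgroup $H$, the double of $G$ over $H$, written $G *_{H} G$, is the free product of $G$ with itself amalgamated over $H$, i.e. the pushout of two copies of the inclusion $H \hookrightarrow G$. For a property $P$, a group is virtually $P$ if some subgroup of finite index has property $P$; thus a virtually (non-abelian) free group is a group having a subgroup of finite index that is a non-abelian free group.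
   Formalization: The free group in ''virtually (non-abelian) free'' and ''G is a non-abelian free group'' is taken to have finite rank; for infinite rank the claim fails, since the double retracts onto G and so is not finitely generated. *)

(* Defs.v *)
From HB Require Import structures.
From mathcomp Require Import all_boot.

Set Implicit Arguments.
Unset Strict Implicit.
Unset Printing Implicit Defensive.

Local Open Scope group_scope.

(* The groups here may be infinite: they are [groupType]s of [monoid.v], not
   [finGroupType]s.  A subgroup of [G] is an [H : groupClosed G], that is, a
   predicate on [G] containing 1 and closed under product and inverse. *)

Definition subgroup_of (G : groupType) (H : groupClosed G) : Type :=
  {x : G | x \in H}.

Section SubgroupOf.
Variables (G : groupType) (H : groupClosed G).

HB.instance Definition _ := SubChoice.on (subgroup_of H).

Lemma subgroup_of_group_closed : group_closed (fun x : G => x \in H).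
Proof. by split=> [|x y]; [exact: gpred1 | exact: gpredF]. Qed.

HB.instance Definition _ :=
  SubChoice_isSubGroup.Build G (fun x : G => x \in H) (subgroup_of H)
    subgroup_of_group_closed.

Definition subgroup_incl : {multiplicative subgroup_of H -> G} := val.

End SubgroupOf.

(* The elements [t i] represent the left cosets of [H], each exactly once. *)
Definition has_index (G : groupType) (H : groupClosed G) (n : nat) : Prop :=
  exists t : 'I_n -> G, forall g : G, exists! i : 'I_n, (t i)^-1 * g \in H.

Definition finite_index (G : groupType) (H : groupClosed G) : Prop :=
  exists n, has_index H n.

Definition isomorphic (G K : groupType) : Prop :=
  exists f : {multiplicative G -> K}, bijective f.

Definition virtually (P : groupType -> Prop) (G : groupType) : Prop :=
  exists H : groupClosed G, finite_index H /\ P (subgroup_of H).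

Definition common_finite_index_subgroup (G1 G2 : groupType) : Prop :=
  exists (K : groupType) (H1 : groupClosed G1) (H2 : groupClosed G2),
    [/\ finite_index H1, finite_index H2,
        isomorphic K (subgroup_of H1) & isomorphic K (subgroup_of H2)].

Definition free_basis (I : Type) (F : groupType) (x : I -> F) : Prop :=
  forall (K : groupType) (y : I -> K),
    exists f : {multiplicative F -> K},
      (forall i, f (x i) = y i) /\
      (forall f' : {multiplicative F -> K},
         (forall i, f' (x i) = y i) -> f' =1 f).

Definition free_of_rank (r : nat) (F : groupType) : Prop :=
  exists x : 'I_r -> F, free_basis x.

(* Free groups are the groups F_r with r a natural number: in infinite rank a
   double could not be virtually a product of free groups of finite rank. *)
Definition nonabelian_free (F : groupType) : Prop :=
  (exists r, free_of_rank r F) /\ (exists x y : F, ~ commute x y).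

Definition is_pushout (A B C D : groupType)
    (f : {multiplicative A -> B}) (g : {multiplicative A -> C})
    (i : {multiplicative B -> D}) (j : {multiplicative C -> D}) : Prop :=
  (forall a, i (f a) = j (g a)) /\
  forall (K : groupType) (u : {multiplicative B -> K})
         (v : {multiplicative C -> K}),
    (forall a, u (f a) = v (g a)) ->
    exists w : {multiplicative D -> K},
      ((forall b, w (i b) = u b) /\ (forall c, w (j c) = v c)) /\
      (forall w' : {multiplicative D -> K},
         (forall b, w' (i b) = u b) -> (forall c, w' (j c) = v c) ->
         w' =1 w).

(* [D] is (a model of) the double of [G] over [H]. *)
Definition is_double (G : groupType) (H : groupClosed G) (D : groupType) :
    Prop :=
  exists i j : {multiplicative G -> D},
    is_pushout (subgroup_incl H) (subgroup_incl H) i j.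

(* Main.v *)
Require Import Defs.
From HB Require Import structures.
From mathcomp Require Import all_boot perm boolp.

(** The double splits.  Let [i] and [j] be the two embeddings of [G] in [D].
The fold map [f : D -> G], which is the identity on both copies of [G], has
[i] as a section.  Its kernel [K] is generated by the elements
[(i g)^-1 * j g]; such an element depends only on the right coset [H g] and
is trivial when [g] is in [H], and there are no other relations: [K] is free
on the [n - 1] nontrivial cosets ([double_kernel_basis]).

If [m] lies in every conjugate of [H], then [i m] commutes with all these
generators ([double_kernel_commute]).  Hence, when [N] is a subgroup of finite
index of [G] contained in the normal core of [H], the finite index subgroup
[f^-1(N)] of [D] is isomorphic to [K * N] ([double_preim_prod]).  One takes for
[N] the intersection of the core with a free subgroup of finite index of [G]:
it is free of some finite rank [s >= 2] by the index formula of Schreier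
([Schreier_index_formula]), and [n - 1 >= 2] because [n >= 3].

For the last claim, the stabilizer of a point in a transitive action of
[F_2] on [a - 1] points is free of rank [a] ([free_rank2_subgroup]), so that
[F_a * F_b] is a finite index subgroup of [F_2 * F_2] whenever [a, b >= 2].

Both freeness results are proved without normal forms of words, directly from
the universal property: given the values in [L] of the wanted morphism on a
candidate basis of a subgroup, the ambient group is mapped to a wreath product
[{ffun V -> L} ><| {perm V}], and one coordinate of that map, restricted to the
subgroup, is the wanted morphism. *)

Set Implicit Arguments.
Unset Strict Implicit.
Unset Printing Implicit Defensive.

Local Open Scope group_scope.

(** * Morphisms and subgroups *)

Section Bundling.
Variables (G K : groupType).

(** A multiplicative map as a bundled morphism. *)
Definition hom_of (f : G -> K) (fM : {morph f : x y / x * y}) :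
    {multiplicative G -> K} :=
  HB.pack f (isMultiplicative.Build G K f fM).

Variable f : {multiplicative G -> K}.

Lemma hom1 : f 1 = 1.
Proof. by apply: (mulgI (f 1)); rewrite -gmulfM !mulg1. Qed.

Lemma homV : {morph f : x / x^-1}.
Proof.
by move=> x; apply: (mulgI (f x)); rewrite -gmulfM !mulgV hom1.
Qed.

End Bundling.

(** The subgroup with a given boolean membership predicate. *)
Definition groupClosed_of (G : groupType) (p : pred G) (p1 : p 1)
    (pM : forall x y, p x -> p y -> p (x * y))
    (pV : forall x, p x -> p x^-1) : groupClosed G :=
  HB.pack (p : {pred G}) (isMulClosed.Build G p (fun x y => @pM x y))
   (isMul1Closed.Build G p p1) (isInvClosed.Build G p (fun x => @pV x)).

(** An element of [G] that lies in [H], as an element of the group [H]. *)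
Definition to_subgroup (G : groupType) (H : groupClosed G) (g : G)
    (gH : g \in H) : subgroup_of H := exist _ g gH.

Section Preimage.
Variables (G K : groupType) (f : {multiplicative G -> K}).

Lemma preim_group_subproof (N : groupClosed K) :
  [/\ f 1 \in N, forall x y, f x \in N -> f y \in N -> f (x * y) \in N
    & forall x, f x \in N -> f x^-1 \in N].
Proof.
split=> [|x y|x]; first by rewrite hom1 gpred1.
  by rewrite gmulfM; apply: gpredM.
by rewrite homV gpredV.
Qed.

(** The preimage of a subgroup under a morphism. *)
Definition preim_group (N : groupClosed K) : groupClosed G :=
  let: And3 P1 PM PV := preim_group_subproof N in
  groupClosed_of (p := fun x => f x \in N) P1 PM PV.

Lemma in_preim_group N x : (x \in preim_group N) = (f x \in N).
Proof. by rewrite /preim_group; case: (preim_group_subproof N). Qed.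

Definition trivial_group : groupClosed K.
Proof.
apply: (@groupClosed_of K (fun x => x == 1)) => //
  [x y /eqP-> /eqP->|x /eqP->].
  by rewrite mulg1.
by rewrite invg1.
Defined.

Definition kernel : groupClosed G := preim_group trivial_group.

Lemma in_kernel x : (x \in kernel) = (f x == 1).
Proof. by rewrite in_preim_group. Qed.

Lemma has_index_preim (s : K -> G) (N : groupClosed K) n :
  cancel s f -> has_index N n -> has_index (preim_group N) n.
Proof.
move=> sK [t tN]; exists (s \o t) => g; have [k [kN ku]] := tN (f g).
exists k; split=> [|k'] /=; first by rewrite in_preim_group gmulfM homV sK.
by rewrite in_preim_group gmulfM homV sK => /ku.
Qed.
End Preimage.

Lemma isomorphic_sym (G K : groupType) : isomorphic G K -> isomorphic K G.
Proof.
case=> f [f' fK f'K].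
have f'M : {morph f' : x y / x * y}.
  by move=> x y; apply: (can_inj fK); rewrite gmulfM !f'K.
by exists (hom_of f'M); exists f.
Qed.

Lemma isomorphic_trans (G K L : groupType) :
  isomorphic G K -> isomorphic K L -> isomorphic G L.
Proof.
case=> f bf [h bh]; exists (h \o f : {multiplicative _ -> _}).
exact: bij_comp.
Qed.

Lemma isomorphic_prod (G1 G2 K1 K2 : groupType) :
  isomorphic G1 K1 -> isomorphic G2 K2 ->
  isomorphic (G1 * G2)%type (K1 * K2)%type.
Proof.
move=> [f1 [h1 fK1 hK1]] [f2 [h2 fK2 hK2]].
have fM : {morph (fun g : G1 * G2 => (f1 g.1, f2 g.2)) : x y / x * y}.
  by move=> x y; congr pair; apply: gmulfM.
exists (hom_of fM), (fun k => (h1 k.1, h2 k.2)) => -[a c] /=.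
  by rewrite fK1 fK2.
by rewrite hK1 hK2.
Qed.

Lemma free_of_rank_iso (r : nat) (G K : groupType) :
  isomorphic G K -> free_of_rank r G -> free_of_rank r K.
Proof.
move=> [f bf] [x xF]; have [f' fK f'K] := bf.
have f'M : {morph f' : x y / x * y}.
  by move=> a b; apply: (can_inj fK); rewrite gmulfM !f'K.
pose h := hom_of f'M.
exists (f \o x) => L y; have [u [ux uu]] := xF L y.
exists (u \o h : {multiplicative _ -> _}); split=> [i|w wx k] /=.
  by rewrite fK.
by rewrite -[k in LHS]f'K -(uu (w \o f : {multiplicative _ -> _})).
Qed.

(** * Wreath products *)

Section Wreath.
Variables (V : finType) (L : groupType).

(** The permutational wreath product of [L] by the symmetric group of [V].
Permutations compose from left to right, so the product is
[(s, f) (s', f') = (s s', v |-> f v * f' (s v))]. *)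
Definition wreath : Type := ({perm V} * {ffun V -> L})%type.
HB.instance Definition _ := Choice.on wreath.

Definition wr_mul (a b : wreath) : wreath :=
  (a.1 * b.1, [ffun v => a.2 v * b.2 (a.1 v)]).
Definition wr_one : wreath := (1, [ffun=> 1]).
Definition wr_inv (a : wreath) : wreath :=
  (a.1^-1, [ffun v => (a.2 (a.1^-1 v))^-1]).

Lemma wr_mulA : associative wr_mul.
Proof.
move=> a b c; rewrite /wr_mul /= mulgA; congr pair.
by apply/ffunP=> v; rewrite !ffunE permM mulgA.
Qed.
Lemma wr_mul1g : left_id wr_one wr_mul.
Proof.
case=> a f; rewrite /wr_mul /= mul1g; congr pair.
by apply/ffunP=> v; rewrite !ffunE perm1 mul1g.
Qed.
Lemma wr_mulg1 : right_id wr_one wr_mul.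
Proof.
case=> a f; rewrite /wr_mul /= mulg1; congr pair.
by apply/ffunP=> v; rewrite !ffunE mulg1.
Qed.
Lemma wr_mulVg : left_inverse wr_one wr_inv wr_mul.
Proof.
case=> a f; rewrite /wr_mul /= mulVg; congr pair.
by apply/ffunP=> v; rewrite !ffunE mulVg.
Qed.
Lemma wr_mulgV : right_inverse wr_one wr_inv wr_mul.
Proof.
case=> a f; rewrite /wr_mul /= mulgV; congr pair.
by apply/ffunP=> v; rewrite !ffunE permK mulgV.
Qed.
HB.instance Definition _ :=
  isGroup.Build wreath wr_mulA wr_mul1g wr_mulg1 wr_mulVg wr_mulgV.

Lemma wreath_eq (a b : wreath) : a.1 = b.1 -> a.2 =1 b.2 -> a = b.
Proof. by case: a b => [s f] [s' f'] /= -> /ffunP ->. Qed.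
Lemma wreathM1 (a b : wreath) : (a * b).1 = a.1 * b.1.
Proof. by []. Qed.
Lemma wreathM2 (a b : wreath) v : (a * b).2 v = a.2 v * b.2 (a.1 v).
Proof. by rewrite ffunE. Qed.
Lemma wreathV1 (a : wreath) : (a^-1).1 = (a.1)^-1.
Proof. by []. Qed.

(** A permutation action twisted by the coboundary of a function [eta]: the
conjugate of the untwisted lift [g |-> (sigma g, 1)] by [(1, eta)]. *)
Lemma wreath_coboundary (G : groupType) (sigma : {multiplicative G -> {perm V}})
    (eta : V -> L) :
  exists c : {multiplicative G -> wreath},
    (forall g, (c g).1 = sigma g) /\
    (forall g v, (c g).2 v = (eta v)^-1 * eta (sigma g v)).
Proof.
pose c g : wreath := (sigma g, [ffun v => (eta v)^-1 * eta (sigma g v)]).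
have cM : {morph c : g g' / g * g'}.
  move=> g g'; apply: wreath_eq => [|v]; first exact: gmulfM.
  by rewrite wreathM2 /= !ffunE gmulfM permM mulgA mulgK.
by exists (hom_of cM); split=> // g v; rewrite /= ffunE.
Qed.
End Wreath.

(** * Free groups *)

Section Free.
Variables (I : Type) (F : groupType) (x : I -> F).
Hypothesis xF : free_basis x.

(** A free basis generates: the map of [F] onto the subgroup cut out by [p]
that fixes the basis must be the identity. *)
Lemma free_basis_ind (p : pred F) :
  p 1 -> (forall a b, p a -> p b -> p (a * b)) -> (forall a, p a -> p a^-1) ->
  (forall i, p (x i)) -> forall g, p g.
Proof.
move=> p1 pM pV px g; pose P := groupClosed_of p1 pM pV.
have [f [fx _]] := xF (fun i => to_subgroup (H := P) (px i)).
have [h [hx hu]] := xF x.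
rewrite -[g]/(idfun g) (hu (idfun : {multiplicative _ -> _})) //.
rewrite -(hu ((subgroup_incl P) \o f : {multiplicative _ -> _})) /=.
  exact: (valP (f g)).
by move=> i /=; rewrite fx.
Qed.

Lemma free_basis_eq (L : groupType) (f f' : {multiplicative F -> L}) :
  (forall i, f (x i) = f' (x i)) -> f =1 f'.
Proof.
move=> ff'; have [h [_ hu]] := xF (f \o x).
by move=> g; rewrite (hu f) // (hu f') //= => i; rewrite -ff'.
Qed.

End Free.

Lemma free_of_rank_isomorphic r (F F' : groupType) :
  free_of_rank r F -> free_of_rank r F' -> isomorphic F F'.
Proof.
move=> [x xF] [y yF]; have [f [fx _]] := xF _ y; have [h [hy _]] := yF _ x.
exists f; exists h => g.
  apply: (free_basis_eq xF (f := h \o f : {multiplicative _ -> _})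
    (f' := idfun : {multiplicative _ -> _})) => i /=.
  by rewrite fx.
apply: (free_basis_eq yF (f := f \o h : {multiplicative _ -> _})
  (f' := idfun : {multiplicative _ -> _})) => i /=.
by rewrite hy.
Qed.

Lemma free_abelian r (F : groupType) (x : 'I_r -> F) : free_basis x ->
  (forall i j, commute (x i) (x j)) -> forall a b : F, commute a b.
Proof.
move=> xF xx.
have com_ind (c : F) : (forall i, commute c (x i)) -> forall a, commute c a.
  move=> cx a; apply/eqP; move: a; apply: (free_basis_ind xF).
  - by rewrite mulg1 mul1g.
  - by move=> a b /eqP ca /eqP cb; apply/eqP; apply: commuteM.
  - by move=> a /eqP ca; apply/eqP; apply: commuteV.
  - by move=> i; apply/eqP; apply: cx.
move=> a; apply: (com_ind) => i; apply/commute_sym.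
exact: com_ind.
Qed.

Lemma free_rank_nonabelian r (F : groupType) :
  free_of_rank r F -> (exists a b : F, ~ commute a b) -> 2 <= r.
Proof.
move=> [x xF] [a [b nab]]; rewrite ltnNge; apply/negP=> r1; apply: nab.
apply: (free_abelian xF) => i j.
suff -> : i = j by [].
by apply: val_inj; case: r r1 x xF i j => [|[|r]] // _ _ _ [[|i] ?] [[|j] ?].
Qed.

(** Two basis elements are sent to non-commuting transpositions of three points. *)
Lemma free_nonabelian r (F : groupType) :
  free_of_rank r F -> 2 <= r -> nonabelian_free F.
Proof.
move=> Fr r2; split; first by exists r.
have [x xF] := Fr.
have r0 : 0 < r by apply: ltnW.
pose s (i : 'I_r) : {perm 'I_3} :=
  if i == Ordinal r0 then tperm ord0 (inord 1) else tperm ord0 (inord 2).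
have [f [fx _]] := xF _ s.
exists (x (Ordinal r0)), (x (Ordinal r2)) => xx.
have: s (Ordinal r0) * s (Ordinal r2) = s (Ordinal r2) * s (Ordinal r0).
  by rewrite -!fx -!gmulfM xx.
move/permP/(_ ord0); rewrite /s eqxx /= !permM !tpermL.
rewrite !tpermD -?val_eqE /= ?inordK // => /(congr1 val).
by rewrite /= !inordK.
Qed.

(** * Cosets and finite index *)

Section Cosets.
Variables (G : groupType) (H : groupClosed G).

(** [p] sends an element to the number of its right coset [H g], and [t]
chooses a representative of each coset. *)
Definition right_cosets n (p : G -> 'I_n) (t : 'I_n -> G) : Prop :=
  (forall g g', (p g == p g') = (g * g'^-1 \in H)) /\ cancel t p.

Lemma has_index_right_cosets n :
  has_index H n <-> exists p t, @right_cosets n p t.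
Proof.
split=> [[t tH]|[p [t [pH tK]]]].
  have qP g : exists i, (t i)^-1 * g^-1 \in H.
    by have [i [iP _]] := tH g^-1; exists i.
  have [p pP] := choice qP.
  have pu g i : (t i)^-1 * g^-1 \in H -> p g = i.
    move=> Hi; have [k [_ ku]] := tH g^-1.
    by rewrite -(ku i) // (ku _ (pP g)).
  exists p, (fun i => (t i)^-1); split=> [g g'|i].
    apply/eqP/idP=> [pgg|gH].
      have := pP g'; have := pP g; rewrite -pgg -gpredV invgM !invgK => gi gi'.
      by rewrite -(mulgK (t (p g)) g) -mulgA; apply: gpredM.
    have gE : g^-1 = g'^-1 * (g * g'^-1)^-1 by rewrite invgM invgK mulKg.
    apply: pu; rewrite gE.
    by rewrite mulgA; apply: gpredM; rewrite ?gpredV.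
  by apply: pu; rewrite invgK mulVg gpred1.
exists (fun i => (t i)^-1) => g; exists (p g^-1); split=> [|i].
  by rewrite invgK -[g in _ * g]invgK -pH tK.
by rewrite invgK -[g in _ * g]invgK -pH tK => /eqP.
Qed.

Section Action.
Variables (n : nat) (p : G -> 'I_n) (t : 'I_n -> G).
Hypothesis pt : right_cosets p t.

Lemma right_coset_act g g' : p (t (p g) * g') = p (g * g').
Proof.
have [pH tK] := pt; apply/eqP.
by rewrite pH invgM -mulgA (mulgA g') mulgV mul1g -pH tK.
Qed.

Lemma right_coset_act_inj g : injective (fun v => p (t v * g)).
Proof.
have [_ tK] := pt; apply: (can_inj (g := fun v => p (t v * g^-1))) => v /=.
by rewrite right_coset_act -mulgA mulgV mulg1 tK.
Qed.

(** The action of [G] by right translation on the right cosets of [H]; it is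
a morphism because permutations compose from left to right. *)
Definition coset_perm (g : G) : {perm 'I_n} := perm (@right_coset_act_inj g).

Lemma coset_permM : {morph coset_perm : g g' / g * g'}.
Proof.
move=> g g'; apply/permP=> v; rewrite permM !permE right_coset_act.
by rewrite mulgA.
Qed.

Definition coset_hom : {multiplicative G -> {perm 'I_n}} := hom_of coset_permM.

Lemma coset_homE g g' : coset_hom g' (p g) = p (g * g').
Proof. by rewrite permE right_coset_act. Qed.

(** [H] is the stabilizer of its own coset, numbered [p 1]. *)
Lemma coset_hom_stab g : (coset_hom g (p 1) == p 1) = (g \in H).
Proof. by rewrite coset_homE mul1g pt.1 invg1 mulg1. Qed.

End Action.

Lemma left_coset_trans x y z :
  x^-1 * y \in H -> y^-1 * z \in H -> x^-1 * z \in H.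
Proof. by move=> xy yz; rewrite -(mulVKg y z) mulgA gpredM. Qed.

(** A subgroup has finite index as soon as some map to a finite type
separates its left cosets; the map need not be constant on cosets. *)
Lemma finite_index_fibres (T : finType) (f : G -> T) :
  (forall g g', f g = f g' -> g^-1 * g' \in H) -> finite_index H.
Proof.
move=> fH.
have [rep repP] : exists rep : T -> G, forall g, f (rep (f g)) = f g.
  have /choice[rep repP] : forall a : T, exists r : G,
      forall g, f g = a -> f r = a.
    move=> a; have [[g ga]|na] := pselect (exists g, f g = a).
      by exists g.
    by exists 1 => g ga; case: na; exists g.
  by exists rep => g; apply: repP.
(* [can a] is a chosen index [b] with [rep b] in the left coset of [rep a]; it
   depends on that coset only. *)
pose same a b := (rep a)^-1 * rep b \in H.
pose can a := odflt a [pick b | same a b].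
have sameC a b : same a b = same b a.
  by rewrite /same -gpredV invgM invgK.
have sameT a b c : same a b -> same b c -> same a c.
  exact: left_coset_trans.
have canP a b : same a b -> can a = can b.
  move=> ab; rewrite /can (eq_pick (Q := same b)) => [|c].
    by case: pickP => //= /(_ b); rewrite /same mulVg gpred1.
  by apply/idP/idP; apply: sameT; rewrite // sameC.
have canS a : same a (can a).
  rewrite /can; case: pickP => //= _; by rewrite /same mulVg gpred1.
pose B := [set can a | a in T].
exists #|B|, (rep \o enum_val) => g /=.
have can_fg : can (f g) \in B by apply: imset_f.
exists (enum_rank_in can_fg (can (f g))); split=> [|k kH].
  rewrite enum_rankK_in //.
  apply: (left_coset_trans (y := rep (f g))); last exact: fH.
  by rewrite -/(same _ _) sameC.
apply: enum_val_inj; rewrite enum_rankK_in //.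
have /imsetP[a _ ka] := enum_valP k; rewrite ka in kH *.
rewrite (canP _ _ (canS a)); apply: canP.
rewrite sameC; apply: (left_coset_trans kH).
by rewrite -gpredV invgM invgK; apply: fH.
Qed.
End Cosets.

Section FiniteIndex.
Variable G : groupType.
Implicit Types H N : groupClosed G.

Lemma finite_index_has_fibres H : finite_index H ->
  exists (T : finType) (f : G -> T),
    forall g g', f g = f g' -> g^-1 * g' \in H.
Proof.
case=> n /has_index_right_cosets[p [t [pH _]]].
exists 'I_n, (fun g => p g^-1) => g g' pgg.
by have := pH g^-1 g'^-1; rewrite pgg eqxx invgK.
Qed.

Lemma has_index_stab n (rho : {multiplicative G -> {perm 'I_n}}) b
    (S : groupClosed G) :
  (forall g, (g \in S) = (rho g b == b)) -> (forall v, exists g, rho g b = v) ->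
  has_index S n.
Proof.
move=> SE /choice[t tb]; apply/has_index_right_cosets.
exists (fun g => rho g b), t; split=> // g g'.
by rewrite SE gmulfM homV permM (canF_eq (permK _)) invgK.
Qed.

Lemma has_index_gt0 H n : has_index H n -> 0 < n.
Proof. by case=> t /(_ 1)[[k ltkn] _]; apply: leq_ltn_trans ltkn. Qed.

End FiniteIndex.

Lemma finite_index_prod (F1 F2 : groupType) (H1 : groupClosed F1)
    (H2 : groupClosed F2) : finite_index H1 -> finite_index H2 ->
  exists2 H : groupClosed (F1 * F2)%type, finite_index H &
    isomorphic (subgroup_of H1 * subgroup_of H2)%type (subgroup_of H).
Proof.
move=> /finite_index_has_fibres[T1 [f1 fP1]].
move=> /finite_index_has_fibres[T2 [f2 fP2]].
pose p (g : F1 * F2) := (g.1 \in H1) && (g.2 \in H2).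
have p1 : p 1 by rewrite /p !gpred1.
have pM g h : p g -> p h -> p (g * h).
  by move=> /andP[g1 g2] /andP[h1 h2]; rewrite /p !gpredM.
have pV g : p g -> p g^-1 by rewrite /p !gpredV.
pose H := groupClosed_of p1 pM pV.
have HE g : (g \in H) = (g.1 \in H1) && (g.2 \in H2) by [].
exists H.
  apply: (@finite_index_fibres _ _ (T1 * T2)%type (fun g => (f1 g.1, f2 g.2))).
  by move=> g g' [e1 e2]; rewrite HE fP1 // fP2.
have inH (h : subgroup_of H1 * subgroup_of H2) : (val h.1, val h.2) \in H.
  by rewrite HE (valP h.1) (valP h.2).
pose phi h := to_subgroup (inH h).
have phiM : {morph phi : x y / x * y} by move=> x y; apply: val_inj.
have in1 (h : subgroup_of H) : (val h).1 \in H1 by case/andP: (valP h).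
have in2 (h : subgroup_of H) : (val h).2 \in H2 by case/andP: (valP h).
exists (hom_of phiM), (fun h => (to_subgroup (in1 h), to_subgroup (in2 h))).
  by move=> [h1 h2]; congr pair; apply: val_inj.
by move=> h; apply: val_inj => /=; case: (val h).
Qed.

(** * Subgroups of finite index of free groups *)

Section Cocycle.
Variables (F : groupType) (V : finType) (rho : {multiplicative F -> {perm V}}).

(** [c v g] is the element of [L] read along [g] from the point [v]: the second
component of a lift of [rho] to the wreath product. *)
Definition cocycle (L : groupType) (c : V -> F -> L) : Prop :=
  forall v g g', c v (g * g') = c v g * c (rho g v) g'.

Lemma cocycle1 (L : groupType) (c : V -> F -> L) v : cocycle c -> c v 1 = 1.
Proof.
move=> cM; apply: (mulgI (c v 1)).
by rewrite -{2}[v](perm1 v) -(hom1 rho) -cM !mulg1.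
Qed.

Lemma cocycle_mulV (L : groupType) (c : V -> F -> L) v g : cocycle c ->
  c v g * c (rho g v) g^-1 = 1.
Proof. by move=> cM; rewrite -cM mulgV cocycle1. Qed.

(** Over a free group, a cocycle can be prescribed arbitrarily on a basis. *)
Lemma cocycle_exists (I : Type) (x : I -> F) (L : groupType) (y : V -> I -> L) :
  free_basis x ->
  exists2 c : V -> F -> L, cocycle c & forall v i, c v (x i) = y v i.
Proof.
move=> xF.
have [w [wx _]] :=
  xF _ (fun i => ((rho (x i), [ffun v => y v i]) : wreath V L)).
have fstM : {morph (fun a : wreath V L => a.1) : a b / a * b} by [].
have w1 : (fun g => (w g).1) =1 rho.
  apply: (free_basis_eq xF (f := hom_of fstM \o w : {multiplicative _ -> _})).
  by move=> i /=; rewrite wx.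
exists (fun v g => (w g).2 v) => [v g g'|v i].
  by rewrite gmulfM wreathM2 -w1.
by rewrite wx ffunE.
Qed.

Variables (r : nat) (x : 'I_r -> F) (xF : free_basis x) (b : V).
Hypothesis rho_trans : forall v, exists g, rho g b = v.

(** A tree rooted at [b] in the Schreier graph, whose edges are the pairs
[(v, a)], leading from [v] to [rho (x a) v].  [S] is its set of vertices, [A]
its set of edges, and [tau v] is the word read from [b] to [v] along the tree;
only its values on [S] matter.  That [tau v] is a word in the edges of the tree
is expressed by the last clause: a cocycle which is trivial on the edges is
trivial on [tau v]. *)
Definition subtree (S : {set V}) (A : {set V * 'I_r}) (tau : V -> F) : Prop :=
  [/\ b \in S, tau b = 1, forall v, v \in S -> rho (tau v) b = v,
      forall v a, (v, a) \in A ->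
        [/\ v \in S, rho (x a) v \in S & tau (rho (x a) v) = tau v * x a]
    & forall (L : groupType) (c : V -> F -> L), cocycle c ->
        (forall v a, (v, a) \in A -> c v (x a) = 1) ->
        forall v, v \in S -> c b (tau v) = 1].

(** By finiteness, stability under the generators gives stability under their
inverses.  This is why a spanning tree can be built from positive edges. *)
Lemma stable_set (S : {set V}) : b \in S ->
  (forall v a, v \in S -> rho (x a) v \in S) -> S = setT.
Proof.
move=> bS Sx; apply/setP=> v; rewrite inE.
have [g <-] := rho_trans v.
suff Sg h u : (rho h u \in S) = (u \in S) by rewrite Sg.
move: h u; suff Sh h : [forall u, (rho h u \in S) == (u \in S)].
  by move=> h u; apply/eqP; move: u; apply/forallP.
move: h; apply: (free_basis_ind xF) =>
  [|h h' /forallP hS /forallP hS'|h /forallP hS|a].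
- by apply/forallP=> u; rewrite hom1 perm1.
- by apply/forallP=> u; rewrite gmulfM permM (eqP (hS' _)) (eqP (hS _)).
- by apply/forallP=> u; rewrite -(eqP (hS _)) homV permKV.
have SS : rho (x a) @: S = S.
  apply/eqP; rewrite eqEcard card_imset ?leqnn ?andbT; last exact: perm_inj.
  by apply/subsetP=> _ /imsetP[u uS ->]; apply: Sx.
by apply/forallP=> u; rewrite -{1}SS mem_imset //; exact: perm_inj.
Qed.

Lemma subtree_exists k : k < #|V| ->
  exists (S : {set V}) (A : {set V * 'I_r}) tau,
    [/\ #|S| = k.+1, #|A| = k & subtree S A tau].
Proof.
elim: k => [|k IH] kV.
  exists [set b], set0, (fun=> 1); split; rewrite ?cards1 ?cards0 //.
  split=> [||v|v a|L c cM _ v _]; rewrite ?inE //.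
    by move/eqP->; rewrite hom1 perm1.
  exact: cocycle1.
have [S [A [tau [cS cA [bS tb tS tA tc]]]]] := IH (ltnW kV).
(* An edge leaving S, to be added to the tree together with its end. *)
have [v [a [vS v'S]]] : exists v a, v \in S /\ rho (x a) v \notin S.
  apply/not_existsP => nS; have := kV.
  rewrite -cS (stable_set bS) ?cardsT ?ltnn //.
  move=> v a vS; apply/negPn/negP=> v'S; apply: (nS v); by exists a.
set v' := rho (x a) v in v'S.
pose tau' u := if u == v' then tau v * x a else tau u.
have tau'S u : u \in S -> tau' u = tau u.
  by rewrite /tau'; case: eqP => // -> /(negP v'S).
have tau'v : tau' v' = tau v * x a by rewrite /tau' eqxx.
have vaA : (v, a) \notin A by apply: contra v'S => /tA[].
exists (v' |: S), ((v, a) |: A), tau'; split.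
- by rewrite cardsU1 v'S cS.
- by rewrite cardsU1 vaA cA.
split.
- by rewrite inE bS orbT.
- by rewrite tau'S.
- move=> u /setU1P[->|uS]; last by rewrite tau'S ?tS.
  by rewrite tau'v gmulfM permM tS.
- move=> u d /setU1P[[-> ->]|/tA[uS u'S tu]].
    by rewrite !inE vS eqxx orbT; split=> //; rewrite tau'v tau'S.
  by rewrite !inE uS u'S !orbT !tau'S.
move=> L c cM cA' u.
have cS' w : w \in S -> c b (tau w) = 1.
  by apply: tc => // w' d wdA; apply: cA'; rewrite inE wdA orbT.
move=> /setU1P[->|uS]; last by rewrite tau'S ?cS'.
by rewrite tau'v cM cS' // tS // cA' ?setU11 ?mulg1.
Qed.

Lemma spanning_tree : exists (A : {set V * 'I_r}) tau,
  #|A| = #|V|.-1 /\ subtree setT A tau.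
Proof.
have V0 : 0 < #|V| by apply/card_gt0P; exists b.
have [|S [A [tau [cS cA T]]]] := @subtree_exists #|V|.-1.
  by rewrite prednK.
have -> : setT = S.
  by apply/esym/eqP; rewrite eqEcard subsetT cardsT cS prednK /=.
by exists A, tau.
Qed.

End Cocycle.

(** The elements [tau v * x a * (tau (rho (x a) v))^-1] with [(v, a)] outside a
spanning tree form a basis of [H].  There are [n * r] edges in the Schreier
graph and [n - 1] in the tree. *)
Theorem Schreier_index_formula (F : groupType) (r n : nat) (H : groupClosed F) :
  free_of_rank r F -> has_index H n ->
  free_of_rank (n * r - n.-1) (subgroup_of H).
Proof.
move=> [x xF] /has_index_right_cosets [p [t pt]].
pose rho := coset_hom pt; pose b := p 1.
have rhoE g g' : rho g' (p g) = p (g * g') := coset_homE pt g g'.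
have rho_stab g : (rho g b == b) = (g \in H) := coset_hom_stab pt g.
have rho_trans v : exists g, rho g b = v.
  by exists (t v); rewrite /b rhoE mul1g pt.2.
clearbody rho.
have [A [tau [cA [_ tb tS tA tc]]]] := spanning_tree xF rho_trans.
have {}tS v : rho (tau v) b = v by rewrite tS.
have sP v g : tau v * g * (tau (rho g v))^-1 \in H.
  rewrite -rho_stab !gmulfM homV !permM tS.
  by rewrite -{2}(tS (rho g v)) permK.
(* s is a groupoid morphism: the element of H obtained by closing up the path
   read along g from v with the tree paths to its ends. *)
pose s v g : subgroup_of H := to_subgroup (sP v g).
have sM v g g' : s v (g * g') = s v g * s (rho g v) g'.
  apply: val_inj; rewrite /= !mulgA gmulfM permM mulgVK.
  by rewrite -!mulgA.
have bH (h : subgroup_of H) : rho (val h) b = b.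
  by apply/eqP; rewrite rho_stab (valP h).
have sb (h : subgroup_of H) : s b (val h) = h.
  by apply: val_inj; rewrite /= bH tb mul1g invg1 mulg1.
have -> : n * r - n.-1 = #|~: A|.
  by rewrite cardsCs setCK card_prod !card_ord cA card_ord.
exists (fun k => let e := enum_val k in s e.1 (x e.2)) => L y.
(* The prescribed value on the edges outside the tree, and 1 on the tree. *)
pose z v a : L :=
  if [pick k : 'I_#|~: A| | enum_val k == (v, a)] is Some k then y k else 1.
have [c cM cx] := cocycle_exists rho z xF.
have cA1 v a : (v, a) \in A -> c v (x a) = 1.
  move=> vaA; rewrite cx /z; case: pickP => // k /eqP kva.
  by have := enum_valP k; rewrite kva inE vaA.
have c1 v : c b (tau v) = 1 by apply: tc.
have fM : {morph (fun h : subgroup_of H => c b (val h)) : h h' / h * h'}.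
  by move=> h h' /=; rewrite cM bH.
pose f := hom_of fM.
have fy k : f (s (enum_val k).1 (x (enum_val k).2)) = y k.
  case kva: (enum_val k) => [v a] /=; rewrite !cM c1 mul1g gmulfM permM tS.
  have := cocycle_mulV b (tau (rho (x a) v)) cM; rewrite c1 mul1g tS => ->.
  rewrite mulg1 cx /z; case: pickP => [k' /eqP k'va|/(_ k)]; last first.
    by rewrite kva eqxx.
  by congr y; apply: enum_val_inj; rewrite k'va.
exists f; split=> // f' f'y h.
have s1 v : s v 1 = 1.
  by apply: val_inj; rewrite /= hom1 perm1 mulg1 mulgV.
have sV v g : s v g^-1 = (s (rho g^-1 v) g)^-1.
  apply/esym/mulg1_eq; have := sM (rho g^-1 v) g g^-1.
  by rewrite homV permKV mulgV s1.
suff /(_ (val h))/forallP/(_ b)/eqP :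
    forall g, [forall v, f' (s v g) == f (s v g)].
  by rewrite sb.
apply: (free_basis_ind xF) => [|g g' /forallP gP /forallP gP'|g /forallP gP|a].
- by apply/forallP=> v; rewrite s1 !hom1.
- by apply/forallP=> v; rewrite sM !gmulfM (eqP (gP _)) (eqP (gP' _)).
- by apply/forallP=> v; rewrite sV !homV (eqP (gP _)).
apply/forallP=> v; have [vaA|vaA] := boolP ((v, a) \in A).
  suff -> : s v (x a) = 1 by rewrite !hom1.
  by apply: val_inj; have [_ _ /= ->] := tA _ _ vaA; rewrite mulgV.
have vaA' : (v, a) \in ~: A by rewrite inE.
have := f'y (enum_rank_in vaA' (v, a)); have := fy (enum_rank_in vaA' (v, a)).
by rewrite enum_rankK_in //= => -> ->.
Qed.

(** [N] is the intersection of [H] with the kernel of [rho]; when [rho] is the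
action on the cosets of a subgroup, that kernel is its normal core. *)
Lemma free_finite_index_core (G : groupType) (V : finType) (H : groupClosed G)
    (rho : {multiplicative G -> {perm V}}) r :
  finite_index H -> free_of_rank r (subgroup_of H) -> 2 <= r ->
  exists N : groupClosed G, [/\ finite_index N, forall m, m \in N -> rho m = 1
    & exists2 s, 2 <= s & free_of_rank s (subgroup_of N)].
Proof.
move=> fH Fr r2.
pose p g := (g \in H) && (rho g == 1).
have p1 : p 1 by rewrite /p gpred1 hom1 /=.
have pM x y : p x -> p y -> p (x * y).
  move=> /andP[xH /eqP x1] /andP[yH /eqP y1]; rewrite /p gpredM //=.
  by rewrite gmulfM x1 y1 mulg1.
have pV x : p x -> p x^-1.
  by move=> /andP[xH /eqP x1]; rewrite /p gpredV xH homV x1 invg1 /=.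
pose N := groupClosed_of p1 pM pV.
have NE g : (g \in N) = (g \in H) && (rho g == 1) by [].
exists N; split.
- have [T [f fP]] := finite_index_has_fibres fH.
  apply: (@finite_index_fibres _ _ (T * {perm V})%type (fun g => (f g, rho g))).
  move=> g g' [fgg rgg]; rewrite NE fP //=.
  by rewrite gmulfM homV rgg mulVg.
- by move=> m; rewrite NE => /andP[_ /eqP].
pose rhoH : {multiplicative _ -> _} := rho \o subgroup_incl H.
have [n nP] : finite_index (kernel rhoH).
  apply: (@finite_index_fibres _ _ {perm V} rhoH) => g g' gg.
  by rewrite in_kernel gmulfM homV gg mulVg.
exists (n * r - n.-1).
  case: n nP => [/has_index_gt0//|n _] /=.
  apply: leq_trans (leq_sub2r n (leq_mul (leqnn n.+1) r2)).
  by rewrite muln2 -addnn addSn -addnS addKn.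
apply: free_of_rank_iso (Schreier_index_formula Fr nP).
have inN (k : subgroup_of (kernel rhoH)) : val (val k) \in N.
  by have := valP k; rewrite in_kernel NE (valP (val k)).
pose phi k := to_subgroup (inN k).
have phiM : {morph phi : x y / x * y} by move=> x y; apply: val_inj.
have inH (m : subgroup_of N) : val m \in H by case/andP: (valP m).
have inK (m : subgroup_of N) : to_subgroup (inH m) \in kernel rhoH.
  by rewrite in_kernel; case/andP: (valP m).
exists (hom_of phiM), (fun m => to_subgroup (inK m)) => k.
  by do 2 apply: val_inj.
by apply: val_inj.
Qed.

(** [H] is the stabilizer of a point when one generator acts as a cycle of
length [a - 1] and the other acts trivially. *)
Lemma free_rank2_subgroup (F : groupType) a : free_of_rank 2 F -> 2 <= a ->
  exists2 H : groupClosed F, finite_index H & free_of_rank a (subgroup_of H).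
Proof.
move=> F2; have [x xF] := F2; case: a => [|[|k]] // _.
pose y (i : 'I_2) : {perm 'I_k.+1} :=
  if i == ord0 then perm (@ordS_inj _) else 1.
have [rho [rhox _]] := xF _ y.
pose p g := rho g ord0 == ord0.
have p1 : p 1 by rewrite /p hom1 perm1.
have pM g h : p g -> p h -> p (g * h).
  by move=> /eqP g0 /eqP h0; rewrite /p gmulfM permM g0 h0.
have pV g : p g -> p g^-1.
  by move=> /eqP g0; rewrite /p homV -{1}g0 permK.
pose H := groupClosed_of p1 pM pV.
have HE g : (g \in H) = (rho g ord0 == ord0) by [].
have powE m : m < k.+1 -> rho (x ord0 ^+ m) ord0 = m :> nat.
  elim: m => [|m IH] mk; first by rewrite expg0 hom1 perm1.
  rewrite expgSr gmulfM permM rhox /y eqxx permE /= IH 1?ltnW //.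
  by rewrite modn_small.
have Hi : has_index H k.+1.
  apply: (has_index_stab HE) => v; exists (x ord0 ^+ v).
  by apply: val_inj; rewrite /= powE.
exists H; first by exists k.+1.
have := Schreier_index_formula F2 Hi.
suff -> : k.+1 * 2 - k.+1.-1 = k.+2 by [].
by rewrite muln2 -addnn addSn -addnS addKn.
Qed.

Lemma nonabelian_free_virtually (G : groupType) :
  nonabelian_free G -> virtually nonabelian_free G.
Proof.
move=> [[r Fr] [a [b nab]]].
pose T : groupClosed G := groupClosed_of (p := predT) isT
  (fun _ _ _ _ => isT) (fun _ _ => isT).
have inT g : g \in T by [].
exists T; split.
  by exists 1%N, (fun=> 1) => g; exists ord0; split=> // k _; rewrite [k]ord1.
split.
  exists r; apply: free_of_rank_iso Fr.
  have sM : {morph (fun g => to_subgroup (inT g)) : x y / x * y}.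
    by move=> x y; apply: val_inj.
  by exists (hom_of sM), val => // k; apply: val_inj.
by exists (to_subgroup (inT a)), (to_subgroup (inT b)) => /(congr1 val).
Qed.

(** * Doubles *)

Section Double.
Variables (G : groupType) (H : groupClosed G) (D : groupType).
Variables (i j : {multiplicative G -> D}).
Hypothesis ij : is_pushout (subgroup_incl H) (subgroup_incl H) i j.

Lemma double_amalg h : h \in H -> i h = j h.
Proof. by move=> hH; apply: (ij.1 (to_subgroup hH)). Qed.

(** A double is generated by its two copies of [G]. *)
Lemma double_ind (P : D -> Prop) :
  P 1 -> (forall a b, P a -> P b -> P (a * b)) -> (forall a, P a -> P a^-1) ->
  (forall g, P (i g)) -> (forall g, P (j g)) -> forall d, P d.
Proof.
move=> P1 PM PV Pi Pj d.
have p1 : `[< P 1 >] by apply/asboolP.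
have pM a b : `[< P a >] -> `[< P b >] -> `[< P (a * b) >].
  by move=> /asboolP Pa /asboolP Pb; apply/asboolP; apply: PM.
have pV a : `[< P a >] -> `[< P a^-1 >].
  by move=> /asboolP Pa; apply/asboolP; apply: PV.
pose Q := groupClosed_of p1 pM pV.
have iQ g : i g \in Q by apply/asboolP.
have jQ g : j g \in Q by apply/asboolP.
pose u g := to_subgroup (iQ g); pose v g := to_subgroup (jQ g).
have uM : {morph u : x y / x * y} by move=> x y; apply: val_inj; exact: gmulfM.
have vM : {morph v : x y / x * y} by move=> x y; apply: val_inj; exact: gmulfM.
have [h|w [[wi wj] _]] := ij.2 _ (hom_of uM) (hom_of vM).
  by apply: val_inj; apply: ij.1.
have [h|w0 [_ w0u]] := ij.2 _ i j; first exact: ij.1.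
have := w0u (subgroup_incl Q \o w : {multiplicative _ -> _}).
rewrite -[d]/((idfun : {multiplicative _ -> _}) d) (w0u idfun) // => <-.
- by apply/asboolP; apply: (valP (w d)).
- by move=> g /=; rewrite wi.
- by move=> g /=; rewrite wj.
Qed.

(** The fold map. *)
Lemma double_fold :
  exists f : {multiplicative D -> G}, cancel i f /\ cancel j f.
Proof.
have [//|f [[fi fj] _]] :=
  ij.2 _ (idfun : {multiplicative _ -> _}) (idfun : {multiplicative _ -> _}).
by exists f.
Qed.

Variables (f : {multiplicative D -> G}) (iK : cancel i f) (jK : cancel j f).
Variables (n : nat) (p : G -> 'I_n) (t : 'I_n -> G) (pt : right_cosets H p t).

Let b := p 1.

Lemma double_gen_ker g : (i g)^-1 * j g \in kernel f.
Proof. by rewrite in_kernel gmulfM homV iK jK mulVg. Qed.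

(** The generators of the kernel of the fold map. *)
Definition double_gen g : subgroup_of (kernel f) :=
  to_subgroup (double_gen_ker g).

Lemma double_gen_coset g : double_gen (t (p g)) = double_gen g.
Proof.
apply: val_inj => /=.
have [h hH gE] : exists2 h, h \in H & g = h * t (p g).
  by exists (g * (t (p g))^-1); rewrite ?mulgVK // -pt.1 pt.2.
by rewrite [in RHS]gE !gmulfM (double_amalg hH) invgM -mulgA mulKg.
Qed.

Lemma double_gen_b : double_gen (t b) = 1.
Proof.
by rewrite double_gen_coset; apply: val_inj; rewrite /= !hom1 invg1 mulg1.
Qed.

(** One generator for each right coset of [H] other than [H] itself, which is
numbered [b]. *)
Definition double_basis (k : 'I_n.-1) : subgroup_of (kernel f) :=
  double_gen (t (lift b k)).

(** The kernel is generated by the [double_gen g].  The elements [i c] form a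
transversal of the kernel, and [s c d] is the corresponding Schreier generator:
it is trivial for [d] in the first copy of [G] and a quotient of two
[double_gen] for [d] in the second, while [s 1 d = d] for [d] in the kernel. *)
Lemma double_kernel_unique (L : groupType)
    (u v : {multiplicative subgroup_of (kernel f) -> L}) :
  (forall k, u (double_basis k) = v (double_basis k)) -> u =1 v.
Proof.
move=> uv; have uvg g : u (double_gen g) = v (double_gen g).
  rewrite -double_gen_coset.
  case: (unliftP b (p g)) => [k|] ->; first exact: uv.
  by rewrite double_gen_b !hom1.
have sP c d : (i (f d * c))^-1 * d * i c \in kernel f.
  by rewrite in_kernel !gmulfM homV !gmulfM !iK invgM -!mulgA mulKg mulVg.
pose s c d := to_subgroup (sP c d).
have s1 c : s c 1 = 1.
  by apply: val_inj; rewrite /= hom1 mul1g mulg1 mulVg.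
have sM c d d' : s c (d * d') = s (f d' * c) d * s c d'.
  apply: val_inj; rewrite /= -!mulgA mulVKg.
  by rewrite !gmulfM !mulgA.
suff uvs : forall d c, u (s c d) = v (s c d).
  move=> k; have -> : k = s 1 (val k); last exact: uvs.
  apply: val_inj; rewrite /= mulg1.
  have := valP k; rewrite in_kernel => /eqP ->.
  by rewrite hom1 invg1 mul1g mulg1.
apply: double_ind => [c|d d' IH IH' c|d IH c|g c|g c].
- by rewrite s1 !hom1.
- by rewrite sM !gmulfM IH IH'.
- have -> : s c d^-1 = (s (f d^-1 * c) d)^-1.
    by apply/esym/mulg1_eq; rewrite -sM mulgV s1.
  by rewrite !homV IH.
- suff -> : s c (i g) = 1 by rewrite !hom1.
  by apply: val_inj; rewrite /= iK gmulfM -!mulgA mulVg.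
suff -> : s c (j g) = double_gen (g * c) * (double_gen c)^-1.
  by rewrite !gmulfM !homV !uvg.
by apply: val_inj; rewrite /= jK !gmulfM (invgM (i c)^-1) invgK -!mulgA mulVKg.
Qed.

(** The two lifts of [sigma] to the wreath product, the plain one on the second
copy of [G] and the one twisted by [eta] on the first, agree on [H] when [eta]
is [H]-invariant, hence define a map on the double.  Its permutation part is
trivial on the kernel, so there its coordinate at [a] is a morphism. *)
Lemma double_kernel_coboundary (W : finType) (L : groupType)
    (sigma : {multiplicative G -> {perm W}}) (eta : W -> L) (a : W) :
  (forall h c, h \in H -> eta (sigma h c) = eta c) ->
  exists u : {multiplicative subgroup_of (kernel f) -> L},
    forall g, u (double_gen g) = (eta a)^-1 * eta (sigma g^-1 a).
Proof.
move=> etaH.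
have [c1 [c1_1 c1_2]] := wreath_coboundary sigma (fun=> 1 : L).
have [c2 [c2_1 c2_2]] := wreath_coboundary sigma eta.
have [h|w [[wi wj] _]] := ij.2 (wreath W L) c2 c1.
  apply: wreath_eq => [|x]; first by rewrite c1_1 c2_1.
  by rewrite c1_2 c2_2 etaH ?(valP h) // invg1 mulg1 mulVg.
have wf : forall d, (w d).1 = sigma (f d).
  apply: double_ind => [|d d' IH IH'|d IH|g|g].
  - by rewrite !hom1.
  - by rewrite !gmulfM wreathM1 IH IH'.
  - by rewrite !homV wreathV1 IH.
  - by rewrite wi iK c2_1.
  - by rewrite wj jK c1_1.
have w1 (k : subgroup_of (kernel f)) : (w (val k)).1 = 1.
  by have := valP k; rewrite in_kernel => /eqP fk; rewrite wf fk hom1.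
have uM : {morph (fun k : subgroup_of (kernel f) => (w (val k)).2 a) :
    k k' / k * k'}.
  by move=> k k'; rewrite gmulfM wreathM2 w1 perm1.
exists (hom_of uM) => g; rewrite [LHS]/= -homV gmulfM wreathM2 wi wj.
by rewrite c2_2 c1_2 invg1 !mulg1.
Qed.

(** The previous lemma is used for the regular action of [G] on the group of
permutations of the cosets, with [eta a] depending on [a^-1 b] only. *)
Lemma double_kernel_exists (L : groupType) (y : 'I_n.-1 -> L) :
  exists u : {multiplicative subgroup_of (kernel f) -> L},
    forall k, u (double_basis k) = y k.
Proof.
pose rho := coset_hom pt.
pose reg g : {perm {perm 'I_n}} := perm (mulIg (rho g)).
have regM : {morph reg : g g' / g * g'}.
  by move=> g g'; apply/permP=> a; rewrite permM !permE gmulfM mulgA.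
have regE g a : hom_of regM g a = a * rho g by rewrite permE.
pose Y v := if unlift b v is Some k then y k else 1.
have [h a hH|u uE] := double_kernel_coboundary (sigma := hom_of regM)
    (eta := fun a => Y (a^-1 b)) 1.
  have hb : rho h b = b by apply/eqP; rewrite coset_hom_stab.
  by rewrite regE invgM permM -{1}hb permK.
exists u => k; rewrite /double_basis uE regE mul1g invg1 perm1 -homV invgK.
by rewrite coset_homE mul1g pt.2 /Y unlift_none liftK invg1 mul1g.
Qed.

Lemma double_kernel_basis : free_basis double_basis.
Proof.
move=> L y; have [u uy] := double_kernel_exists y; exists u; split=> // v vy.
by apply: double_kernel_unique => k; rewrite vy uy.
Qed.

(** An element [m] fixing all cosets of [H] lies in the normal core of [H]. *)
Lemma double_kernel_commute (k : subgroup_of (kernel f)) m :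
  (forall v, coset_hom pt m v = v) -> commute (val k) (i m).
Proof.
move=> m1; apply/eqP; move: k; apply: (free_basis_ind double_kernel_basis).
- by rewrite mulg1 mul1g.
- move=> k k' /eqP km /eqP k'm; apply/eqP; apply/commute_sym.
  by apply: commuteM; apply: commute_sym.
- by move=> k /eqP km; apply/eqP; apply/commute_sym/commuteV/commute_sym.
move=> k /=; set g := t _.
have gm : g * m * g^-1 \in H by rewrite -pt.1 -(coset_homE pt) m1.
have mH : m \in H by rewrite -(coset_hom_stab pt) m1.
have gmE : g * m = (g * m * g^-1) * g by rewrite mulgVK.
rewrite (double_amalg mH) -mulgA -gmulfM gmE gmulfM -(double_amalg gm) mulgA.
by rewrite -homV -gmulfM mulgA mulKg gmulfM homV -mulgA (double_amalg mH).
Qed.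

Lemma double_preim_prod (N : groupClosed G) :
  (forall m v, m \in N -> coset_hom pt m v = v) ->
  isomorphic (subgroup_of (preim_group f N))
             (subgroup_of (kernel f) * subgroup_of N)%type.
Proof.
move=> Nv; apply: isomorphic_sym.
have com (k : subgroup_of (kernel f)) (m : subgroup_of N) :
    commute (val k) (i (val m)).
  by apply: double_kernel_commute => v; apply: Nv; apply: (valP m).
have fk (k : subgroup_of (kernel f)) : f (val k) = 1.
  by apply/eqP; rewrite -in_kernel (valP k).
have inM (km : subgroup_of (kernel f) * subgroup_of N) :
    val km.1 * i (val km.2) \in preim_group f N.
  by rewrite in_preim_group gmulfM fk iK mul1g (valP km.2).
pose phi km := to_subgroup (inM km).
have phiM : {morph phi : a c / a * c}.
  move=> a c; apply: val_inj => /=; rewrite gmulfM !mulgA; congr (_ * _).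
  by rewrite -!mulgA; congr (_ * _); rewrite com.
have in1 (d : subgroup_of (preim_group f N)) :
    val d * (i (f (val d)))^-1 \in kernel f.
  by rewrite in_kernel gmulfM homV iK mulgV.
have in2 (d : subgroup_of (preim_group f N)) : f (val d) \in N.
  by rewrite -in_preim_group (valP d).
exists (hom_of phiM), (fun d => (to_subgroup (in1 d), to_subgroup (in2 d))).
  move=> [k m]; congr pair; apply: val_inj => /=; rewrite gmulfM fk iK mul1g //.
  by rewrite mulgK.
by move=> d; apply: val_inj; rewrite /= mulgVK.
Qed.
End Double.

(** * Conclusion *)

Theorem double_virtually_free_product (G : groupType) (H : groupClosed G) n
    (D : groupType) : has_index H n -> 3 <= n -> is_double H D ->
  virtually nonabelian_free G ->
  exists (M : groupClosed D) (F1 F2 : groupType) (a b : nat),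
    [/\ finite_index M, isomorphic (subgroup_of M) (F1 * F2)%type,
        free_of_rank a F1 /\ 2 <= a & free_of_rank b F2 /\ 2 <= b].
Proof.
move=> /has_index_right_cosets[p [t pt]] n3 [i [j ij]].
move=> [H0 [fH0 [[r Fr] nab]]].
have r2 := free_rank_nonabelian Fr nab.
have [f [iK jK]] := double_fold ij.
have [N [[m mN] N1 [s s2 Fs]]] :=
  free_finite_index_core (coset_hom pt) fH0 Fr r2.
exists (preim_group f N), (subgroup_of (kernel f)), (subgroup_of N), n.-1, s.
split=> //.
- by exists m; apply: has_index_preim iK mN.
- apply: (double_preim_prod ij iK jK (pt := pt)) => g v /N1 ->.
  by rewrite perm1.
- split; last by case: n n3 {p t pt N1} => [|[|[|n]]].
  by exists (double_basis iK jK p t); apply: (double_kernel_basis ij iK jK pt).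
Qed.

Theorem corollary1p6 (G : groupType) (H : groupClosed G) (n : nat)
    (D : groupType) (index_H : has_index H n) (n_ge3 : 3 <= n)
    (double_D : is_double H D) :
  (virtually nonabelian_free G ->
     virtually (fun K : groupType =>
       exists F1 F2 : groupType,
         [/\ nonabelian_free F1, nonabelian_free F2
           & isomorphic K (F1 * F2)%type]) D)
  /\
  (nonabelian_free G ->
     forall F2 : groupType, free_of_rank 2 F2 ->
       common_finite_index_subgroup (F2 * F2)%type D).
Proof.
have virtD := double_virtually_free_product index_H n_ge3 double_D.
split=> [/virtD|freeG F fF].
  move=> [M [F1 [F2 [a [b [fM iM [F1a a2] [F2b b2]]]]]]].
  exists M; split=> //; exists F1, F2; split=> //.
    exact: free_nonabelian F1a a2.
  exact: free_nonabelian F2b b2.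
have /virtD[M [F1 [F2 [a [b [fM iM [F1a a2] [F2b b2]]]]]]] :=
  nonabelian_free_virtually freeG.
have [Ha fa Fa] := free_rank2_subgroup fF a2.
have [Hb fb Fb] := free_rank2_subgroup fF b2.
have [P fP iP] := finite_index_prod fa fb.
exists (F1 * F2)%type, P, M; split=> //; last exact: isomorphic_sym.
by apply: isomorphic_trans iP; apply: isomorphic_prod;
  [apply: free_of_rank_isomorphic F1a Fa|apply: free_of_rank_isomorphic F2b Fb].
Qed.
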